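(* On any infinite set $X$ there are exactly $2^{2^{|X|}}$ many precomplete clones.
   Context: For a set $X$, $\mathscr{O}^{(n)}$ is the set of all functions $X^n\to X$ ($n\ge1$) and $\mathscr{O}=\bigcup_{n\ge1}\mathscr{O}^{(n)}$. A clone on $X$ is a set $\mathscr{C}\subseteq\mathscr{O}$ that contains all projections $\pi^n_k(x_1,\dots,x_n)=x_k$ ($1\le k\le n$) and is closed under composition: if $f_1,\dots,f_k\in\mathscr{C}\cap\mathscr{O}^{(n)}$ and $g\in\mathscr{C}\cap\mathscr{O}^{(k)}$, then $(x_1,\dots,x_n)\mapsto g(f_1(x_1,\dots,x_n),\dots,f_k(x_1,\dots,x_n))$ is in $\mathscr{C}$. A precomplete (= maximal) clone is a coatom of the lattice of clones on $X$ ordered by inclusion, i.e., a clone $\mathscr{C}\ne\mathscr{O}$ such that the only clone properly containing $\mathscr{C}$ is $\mathscr{O}$. *)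

(* Defs.v *)
From mathcomp Require Import all_boot.
From mathcomp Require Import boolp classical_sets functions cardinality.

Set Implicit Arguments.
Unset Strict Implicit.
Unset Printing Implicit Defensive.

Local Open Scope classical_set_scope.

(* The functions X^n -> X, with X^n represented as 'I_n -> X. *)
Definition nary (X : Type) (n : nat) : Type := ('I_n -> X) -> X.

(* The disjoint union of the sets of n-ary operations over n >= 1: the tag n
   stands for arity n.+1. *)
Definition operation (X : Type) : Type := {n : nat & nary X n.+1}.

Definition op (X : Type) (n : nat) (f : nary X n.+1) : operation X :=
  existT (fun m => nary X m.+1) n f.

Definition projection (X : Type) (n : nat) (k : 'I_n) : nary X n :=
  fun x => x k.

Definition composition (X : Type) (n k : nat)
    (g : nary X k) (f : 'I_k -> nary X n) : nary X n :=
  fun x => g (fun i => f i x).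

Definition is_clone (X : Type) (C : set (operation X)) : Prop :=
  (forall (n : nat) (k : 'I_n.+1), C (op (@projection X n.+1 k))) /\
  (forall (n k : nat) (g : nary X k.+1) (f : 'I_k.+1 -> nary X n.+1),
      C (op g) -> (forall i, C (op (f i))) -> C (op (composition g f))).

Definition is_precomplete (X : Type) (C : set (operation X)) : Prop :=
  [/\ is_clone C, C <> setT &
      forall D : set (operation X), is_clone D -> C `<` D -> D = setT].

(* Main.v *)
Require Import Defs.
From mathcomp Require Import all_boot.
From mathcomp Require Import boolp classical_sets functions cardinality filter.

(** Every ultrafilter [F] on [X] yields a precomplete clone: the operations that
map powers of null sets to null sets, where a set is null when its complement
is in [F].  An operation [g] outside this clone maps some power [A^k] of a null
set onto a set [B] of [F].  Every operation whose range is null belongs to the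
clone, so [g], fed with a section [B -> A^k], yields every operation with
values in [B]; any operation is then glued from its part in [B] and its part in
the null set [~` B] by an operation that always returns one of its arguments,
which preserves every set ([null_preserving_maximal]).  Distinct ultrafilters
give distinct clones ([null_preserving_inj]): if [A] is in [F] and null for
[G], and, say, [A] is no larger than its complement, then a unary map from
[~` A] onto [A] with values in [A] separates the two clones.

There are [2^2^|X|] ultrafilters, by Hausdorff's independent family of
[2^|X|] subsets of [X] ([independent_family], [ultrafilter_family]).  There
are no more than [2^2^|X|] sets of operations at all, as an operation is
determined by its graph, a set of finite sequences ([card_operation_le]).  Both
counts rest on [|seq X| <= |X|], hence on [|X * X| <= |X|]
([card_square_le]). *)

Set Implicit Arguments.
Unset Strict Implicit.
Unset Printing Implicit Defensive.

Local Open Scope classical_set_scope.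
Local Open Scope card_scope.

(** * Cardinal arithmetic of infinite sets *)

Lemma card_le_inj (T U : Type) (A : set T) (B : set U) (f : T -> U) :
  set_fun A B f -> set_inj A f -> A #<= B.
Proof.
move=> fAB finj; suff [g] : $|{injfun A >-> B}| by exact: inj_card_le g.
by apply/injfunPex; exists f.
Qed.

Lemma card_le_injP (T : Type) (U : pointedType) (A : set T) (B : set U) :
  A #<= B -> exists2 f : T -> U, set_fun A B f & set_inj A f.
Proof. by move=> /pcard_leP /injfunPex. Qed.

Lemma card_leT_injP (T : Type) (U : pointedType) :
  [set: T] #<= [set: U] -> exists f : T -> U, injective f.
Proof.
by move=> /card_le_injP[f _ finj]; exists f => x y; apply: finj; rewrite inE.
Qed.

Lemma card_le_set (T U : Type) :
  [set: T] #<= [set: U] -> [set: set T] #<= [set: set U].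
Proof.
elim/Ppointed: U => U => [|/card_leT_injP[f finj]].
  rewrite card_le_emptyr => /eqP T0.
  apply: (@card_le_inj _ _ _ _ (fun=> set0)) => // A B _ _ _.
  by rewrite -(setIT A) -(setIT B) T0 !setI0.
have sub A B : f @` A = f @` B -> A `<=` B.
  move=> AB x Ax; have : (f @` A) (f x) by exists x.
  by rewrite AB => -[y By /finj <-].
apply: (@card_le_inj _ _ _ _ (fun A => f @` A)) => // A B _ _ AB.
by apply/seteqP; split; exact: sub.
Qed.

(** By Zorn's lemma there is a maximal partial injection from [A] to [B]; one
that misses both a point of [A] and a point of [B] could be extended. *)
Lemma card_le_total (T U : Type) (A : set T) (B : set U) :
  A #<= B \/ B #<= A.
Proof.
elim/Ppointed: T => T in A *; first by left; rewrite !emptyE_subdef.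
elim/Ppointed: U => U in B *; first by right; rewrite !emptyE_subdef.
pose P (G : set (T * U)) := [/\ G `<=` A `*` B,
  forall x y y', G (x, y) -> G (x, y') -> y = y' &
  forall x x' y, G (x, y) -> G (x', y) -> x = x'].
have [F PF Ftot|G [[GAB Gfun Ginj] Gmax]] := @Zorn_bigcup _ P.
  have common u v : (\bigcup_(G in F) G) u -> (\bigcup_(G in F) G) v ->
      exists2 G, F G & G u /\ G v.
    move=> [G FG Gu] [H FH Hv].
    by have [GH|HG] := Ftot _ _ FG FH; [exists H|exists G] => //;
      split=> //; [exact: GH|exact: HG].
  split.
  - by move=> u [G FG Gu]; have [GAB _ _] := PF _ FG; exact: GAB.
  - move=> x y y' /common /[apply] -[G FG [Gy Gy']].
    by have [_ Gfun _] := PF _ FG; exact: Gfun Gy Gy'.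
  - move=> x x' y /common /[apply] -[G FG [Gx Gx']].
    by have [_ _ Ginj] := PF _ FG; exact: Ginj Gx Gx'.
have [GA|nGA] := pselect (forall x, A x -> exists y, G (x, y)).
  left; have /choice[f fG] : forall x, exists y, A x -> G (x, y).
    by move=> x; have [/GA[y]|nAx] := pselect (A x); [exists y|exists point].
  apply: (@card_le_inj _ _ _ _ f) => [x /fG /GAB[]//|x y].
  by rewrite !inE => /fG Gx /fG Gy fxy; apply: Ginj Gx _; rewrite fxy.
have [GB|nGB] := pselect (forall y, B y -> exists x, G (x, y)).
  right; have /choice[f fG] : forall y, exists x, B y -> G (x, y).
    by move=> y; have [/GB[x]|nBy] := pselect (B y); [exists x|exists point].
  apply: (@card_le_inj _ _ _ _ f) => [y /fG /GAB[]//|x y].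
  by rewrite !inE => /fG Gx /fG Gy fxy; apply: Gfun Gx _; rewrite fxy.
move: nGA => /existsNP[a /not_implyP[Aa /forallNP nGa]].
move: nGB => /existsNP[b /not_implyP[Bb /forallNP nGb]].
exfalso; apply: (Gmax (G `|` [set (a, b)])).
  split; first exact: subsetUl.
  by move=> /(_ (a, b)) /(_ (or_intror erefl)); exact: nGa.
split.
- by move=> u [/GAB//|->].
- move=> x y y' [Gxy|[-> ->]] [Gxy'|]; first exact: Gfun Gxy Gxy'.
  + by case=> xa _; case: (nGa y); rewrite -xa.
  + by case: (nGa y').
  + by case.
- move=> x x' y [Gxy|[-> ->]] [Gxy'|]; first exact: Ginj Gxy Gxy'.
  + by case=> _ yb; case: (nGb x); rewrite -yb.
  + by case: (nGb x').
  + by case.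
Qed.

(** The approximations in the Zorn argument for [|X * X| <= |X|]: a set
[carrier] with an injection from its square to itself.  The function [pairing]
is total on [X], so that extension is mere agreement on the smaller square.
The two fixed points of the carrier serve as tags; as soon as they are
distinct, the injection makes the carrier infinite. *)
Record pairing_on (X : Type) (p q : X) := PairingOn {
  carrier : set X;
  pairing : X -> X -> X;
  carrier_p : carrier p;
  carrier_q : carrier q;
  pairing_carrier : forall x y, carrier x -> carrier y -> carrier (pairing x y);
  pairing_inj : forall x y x' y',
    carrier x -> carrier y -> carrier x' -> carrier y' ->
    pairing x y = pairing x' y' -> x = x' /\ y = y' }.

Definition extends_pairing (X : Type) (p q : X) (s t : pairing_on p q) : bool :=
  `[< carrier s `<=` carrier t /\
      forall x y, carrier s x -> carrier s y -> pairing t x y = pairing s x y >].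

(** The union of a chain is paired by choosing, for each [(x, y)], a member of
the chain whose carrier contains both; by totality all choices agree. *)
Lemma max_pairing (X : Type) (p q : X) (t0 : pairing_on p q) :
  exists t : pairing_on p q, premaximal (@extends_pairing X p q) t.
Proof.
apply: (ZL_preorder t0).
- by move=> t; apply/asboolP; split.
- move=> r s t /asboolP[rs Ers] /asboolP[st Est]; apply/asboolP.
  split; first exact: subset_trans st.
  by move=> x y rx ry; rewrite Est ?Ers//; exact: rs.
move=> C Ctot; have [[i0 Ci0]|C0] := pselect (C !=set0); last first.
  by exists t0 => s Cs; case: C0; exists s.
pose A := \bigcup_(t in C) carrier t.
have common x y : A x -> A y -> exists2 t, C t & carrier t x /\ carrier t y.
  move=> [s Cs sx] [t Ct ty].
  have [/asboolP[st _]|/asboolP[ts _]] := Ctot _ _ Cs Ct.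
    by exists t => //; split=> //; exact: st.
  by exists s => //; split=> //; exact: ts.
have /choice[f fP] : forall u, exists z, forall t, C t ->
    carrier t u.1 -> carrier t u.2 -> z = pairing t u.1 u.2.
  move=> [x y] /=; have [[Ax Ay]|nA] := pselect (A x /\ A y); last first.
    by exists x => t Ct tx ty; case: nA; split; exists t.
  have [s Cs [sx sy]] := common _ _ Ax Ay; exists (pairing s x y) => t Ct tx ty.
  have [/asboolP[_ ->]//|/asboolP[_ ->]//] := Ctot _ _ Cs Ct.
have Ap : A p by exists i0 => //; exact: carrier_p.
have Aq : A q by exists i0 => //; exact: carrier_q.
have fA x y : A x -> A y -> A (f (x, y)).
  move=> Ax Ay; have [t Ct [tx ty]] := common _ _ Ax Ay.
  by exists t => //; rewrite (fP _ _ Ct)//; exact: pairing_carrier.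
have finj x y x' y' : A x -> A y -> A x' -> A y' ->
    f (x, y) = f (x', y') -> x = x' /\ y = y'.
  move=> Ax Ay Ax' Ay'.
  have [s Cs [sx sy]] := common _ _ Ax Ay.
  have [t Ct [tx ty]] := common _ _ Ax' Ay'.
  have [u Cu [su tu]] : exists2 u, C u &
      carrier s `<=` carrier u /\ carrier t `<=` carrier u.
    by have [/asboolP[st _]|/asboolP[ts _]] := Ctot _ _ Cs Ct;
      [exists t => //; split|exists s => //; split].
  rewrite !(fP _ _ Cu); [|by auto..].
  by apply: pairing_inj; auto.
exists (PairingOn Ap Aq fA finj) => t Ct; apply/asboolP; split => /=.
  by move=> x tx; exists t.
by move=> x y tx ty; rewrite (fP _ _ Ct).
Qed.

(** If a copy [h @` A] of the carrier [A] fits outside [A], the new pairs of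
points of [A `|` h @` A] can all be sent into [h @` A]: each point is encoded
by its tag ([p] in [A], [q] in the copy) and the element of [A] that it comes
from, and the resulting four elements of [A] are paired down to one. *)
Lemma extend_pairing (X : pointedType) (p q : X) (t : pairing_on p q) :
  p <> q -> carrier t #<= ~` carrier t ->
  exists2 s, extends_pairing t s & ~ carrier s `<=` carrier t.
Proof.
move=> pq /card_le_injP[h hA hinj].
set A := carrier t in hA hinj *; set f := pairing t; pose B := A `|` h @` A.
have fA x y : A x -> A y -> A (f x y) := @pairing_carrier _ _ _ t x y.
have finj x y x' y' : A x -> A y -> A x' -> A y' ->
    f x y = f x' y' -> x = x' /\ y = y' := @pairing_inj _ _ _ t x y x' y'.
pose h' := pinv A h.
have h'K x : A x -> h' (h x) = x by move=> Ax; apply: pinvKV; rewrite ?inE.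
pose a x := if x \in A then x else h' x.
pose tag x := if x \in A then p else q.
pose code x y := f (f (tag x) (tag y)) (f (a x) (a y)).
pose g x y := if (x \in A) && (y \in A) then f x y else h (code x y).
have aA x : B x -> A (a x).
  rewrite /a; case: (boolP (x \in A)) => [/set_mem//|/negP nAx [/mem_set//|]].
  by move=> [y Ay <-]; rewrite h'K.
have tagA x : A (tag x).
  by rewrite /tag; case: ifP => _; [exact: carrier_p|exact: carrier_q].
have tag_inj x y : B x -> B y -> tag x = tag y -> a x = a y -> x = y.
  rewrite /tag /a.
  case: (boolP (x \in A)) => [_|/negP nAx];
    case: (boolP (y \in A)) => [_|/negP nAy].
  - by [].
  - by [].
  - by move=> _ _ /esym.
  - move=> [/mem_set//|[u Au <-]] [/mem_set//|[v Av <-]] _.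
    by rewrite !h'K// => ->.
have codeA x y : B x -> B y -> A (code x y).
  move=> /aA ax /aA ay.
  exact: fA (fA _ _ (tagA x) (tagA y)) (fA _ _ ax ay).
have Bp : B p by left; exact: carrier_p.
have Bq : B q by left; exact: carrier_q.
have gB x y : B x -> B y -> B (g x y).
  move=> Bx By; rewrite /g; case: ifP => [/andP[/set_mem Ax /set_mem Ay]|_].
    by left; exact: fA.
  by right; exists (code x y) => //; exact: codeA.
have ginj x y x' y' : B x -> B y -> B x' -> B y' ->
    g x y = g x' y' -> x = x' /\ y = y'.
  move=> Bx By Bx' By'; rewrite /g.
  case: ifP => [/andP[/set_mem Ax /set_mem Ay]|_];
    case: ifP => [/andP[/set_mem Ax' /set_mem Ay']|_].
  - exact: finj.
  - move=> E; have := hA _ (codeA _ _ Bx' By').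
    by rewrite -E => /(_ (fA _ _ Ax Ay)).
  - move=> E; have := hA _ (codeA _ _ Bx By).
    by rewrite E => /(_ (fA _ _ Ax' Ay')).
  - move=> /hinj; rewrite !inE => /(_ (codeA _ _ Bx By) (codeA _ _ Bx' By')) E.
    have [ax ay] := (aA _ Bx, aA _ By); have [ax' ay'] := (aA _ Bx', aA _ By').
    have [Et Ea] := finj _ _ _ _ (fA _ _ (tagA x) (tagA y)) (fA _ _ ax ay)
      (fA _ _ (tagA x') (tagA y')) (fA _ _ ax' ay') E.
    have [tx ty] := finj _ _ _ _ (tagA x) (tagA y) (tagA x') (tagA y') Et.
    have [ex ey] := finj _ _ _ _ ax ay ax' ay' Ea.
    by split; apply: tag_inj.
exists (PairingOn Bp Bq gB ginj).
  apply/asboolP; split=> /= [x Ax|x y Ax Ay]; first by left.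
  by rewrite /g !mem_set.
move=> /= /(_ (h p)) BA; apply: (hA p); first exact: carrier_p.
by apply: BA; right; exists p => //; exact: carrier_p.
Qed.

(** A maximal pairing has a carrier [A] with [|~` A| <= |A|], since otherwise
[extend_pairing] applies.  Then [X] injects into [A] by the same tagging,
and the square of [X] into the square of [A]. *)
Lemma card_square_le (X : Type) :
  infinite_set [set: X] -> [set: X * X] #<= [set: X].
Proof.
elim/Ppointed: X => X; first by rewrite emptyE => /(_ (finite_set0 _)).
move=> /infiniteP/card_leT_injP[e einj].
pose e' := pinv [set: nat] e.
have e'K n : e' (e n) = n by apply: pinvKV; rewrite ?inE// => x y _ _ /einj.
pose p := e 0; pose q := e 1.
have pq : p <> q by move=> /einj.
(* The initial pairing lives on a countable subset of [X] and comes from a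
   pairing of natural numbers. *)
pose A0 := range e; pose f0 x y := e (pickle (e' x, e' y)).
have A0p : A0 p by exists 0.
have A0q : A0 q by exists 1.
have f0A x y : A0 x -> A0 y -> A0 (f0 x y) by exists (pickle (e' x, e' y)).
have f0inj x y x' y' : A0 x -> A0 y -> A0 x' -> A0 y' ->
    f0 x y = f0 x' y' -> x = x' /\ y = y'.
  move=> [m _ <-] [n _ <-] [m' _ <-] [n' _ <-]; rewrite /f0 !e'K.
  by move=> /einj /(pcan_inj pickleK)[-> ->].
have [t tmax] := max_pairing (PairingOn A0p A0q f0A f0inj).
have [tC|] := card_le_total (carrier t) (~` carrier t).
  have [s ts nst] := extend_pairing pq tC.
  by have /asboolP[st _] := tmax _ ts.
move=> /card_le_injP[k kA kinj].
set A := carrier t in k kA kinj.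
pose a x := if x \in A then x else k x.
pose tag x := if x \in A then p else q.
have aA x : A (a x).
  by rewrite /a; case: (boolP (x \in A)) => [/set_mem//|/negP nAx];
    apply: kA => Ax; apply: nAx; rewrite inE.
have tagA x : A (tag x).
  by rewrite /tag; case: ifP => _; [exact: carrier_p|exact: carrier_q].
have tag_inj x y : tag x = tag y -> a x = a y -> x = y.
  rewrite /tag /a.
  case: (boolP (x \in A)) => [_|nAx]; case: (boolP (y \in A)) => [_|nAy].
  - by [].
  - by [].
  - by move=> /esym.
  - by move=> _; apply: kinj; rewrite in_setC.
pose c x := pairing t (tag x) (a x).
have cA x : A (c x) by exact: (pairing_carrier (tagA x) (aA x)).
have cinj x y : c x = c y -> x = y.
  move=> E; have [] := pairing_inj (tagA x) (aA x) (tagA y) (aA y) E.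
  exact: tag_inj.
apply: (@card_le_inj _ _ _ _ (fun u => pairing t (c u.1) (c u.2))) => //.
move=> [x y] [x' y'] _ _ /= E.
by have [/cinj -> /cinj ->] := pairing_inj (cA x) (cA y) (cA x') (cA y') E.
Qed.

(** A sequence is coded by its length and the iterated pairing of its items;
the length makes the code injective. *)
Lemma card_seq_le (X : Type) :
  infinite_set [set: X] -> [set: seq X] #<= [set: X].
Proof.
elim/Ppointed: X => X; first by rewrite emptyE => /(_ (finite_set0 _)).
move=> /[dup] /infiniteP/card_leT_injP[e einj].
move=> /card_square_le /card_leT_injP[p pinj].
pose code := foldr (fun x y => p (x, y)) point.
apply: (@card_le_inj _ _ _ _ (fun s => p (e (size s), code s))) => // s t _ _.
move=> /pinj[/einj]; elim: s t => [|x s IHs] [|y t]//= [st] /pinj[-> cst].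
by rewrite (IHs t).
Qed.

(** The ascribed type lets [apply_op o] be applied to arguments, which the type
of [projT2 o] does not show to be possible. *)
Definition apply_op (X : Type) (o : operation X) : nary X (projT1 o).+1 :=
  projT2 o.
Arguments apply_op {X} o _.

(** An operation is determined by the set of the sequences made of a value
followed by the arguments; their length is the arity plus one. *)
Lemma card_operation_le (X : Type) :
  infinite_set [set: X] -> [set: operation X] #<= [set: set X].
Proof.
move=> Xinf; apply: card_le_trans (card_le_set (card_seq_le Xinf)).
have [x0 _] := infinite_setN0 Xinf.
pose graph (o : operation X) : set (seq X) :=
  [set apply_op o x :: [seq x i | i <- enum 'I_(projT1 o).+1] | x in setT].
apply: (@card_le_inj _ _ _ _ graph) => // -[n f] [m g] _ _ E.
(* An arity is read off any member of the graph, and there is one because [X]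
   is inhabited. *)
have nm : n = m.
  have : graph (existT _ n f) (f (fun=> x0) :: [seq x0 | i <- enum 'I_n.+1]).
    by exists (fun=> x0).
  rewrite E => -[x _ /(congr1 size)] /=; rewrite !size_map.
  by rewrite -!enumT !size_enum_ord => -[->].
case: m / nm g E => g E; congr existT; apply/funext => x.
have : graph (existT _ n f) (f x :: [seq x i | i <- enum 'I_n.+1]) by exists x.
rewrite E => -[y _ /= [<- /eq_in_map yx]]; congr g; apply/funext => i.
by apply: yx; rewrite mem_enum.
Qed.

(** * Independent sets and ultrafilters *)

(** Take one point in which [Y] and [Z] differ for every two distinct members
[Y] and [Z] of [L]. *)
Lemma separating_seq (X : Type) (L : seq (set X)) :
  exists s : seq X, forall Y Z, Y \in L -> Z \in L ->
    [seq `[< Y x >] | x <- s] = [seq `[< Z x >] | x <- s] -> Y = Z.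
Proof.
elim/Ppointed: X => X in L *.
  by exists [::] => Y Z _ _ _; rewrite (empty_eq0 Y) (empty_eq0 Z).
have /choice[d dP] : forall u : set X * set X, exists x,
    `[< u.1 x >] = `[< u.2 x >] -> u.1 = u.2.
  move=> [Y Z] /=; apply: contrapT => /forallNP YZ.
  apply: (YZ point) => _; apply/funext => x; apply: contrapT => YZx.
  by apply: (YZ x) => E; case: YZx; exact: propext (asbool_eq_equiv E).
exists [seq d (Y, Z) | Y <- L, Z <- L] => Y Z YL ZL /eq_in_map E.
by apply: (dP (Y, Z)); apply: E; apply/allpairsP; exists (Y, Z).
Qed.

(** Hausdorff's construction: the points of [X] code pairs of a finite sequence
[s] and a finite list [m] of boolean words, and [B Y] is the set of the codes
for which the trace of [Y] on [s] is in [m].  Given [S] and [L], choose [s]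
so that the members of [L] have distinct traces on it, and let [m] list the
traces of those that are in [S]. *)
Lemma independent_family (X : Type) : infinite_set [set: X] ->
  exists B : set X -> set X, forall (S : set (set X)) (L : seq (set X)),
    exists x, forall Y, Y \in L -> B Y x <-> S Y.
Proof.
elim/Ppointed: X => X; first by rewrite emptyE => /(_ (finite_set0 _)).
move=> /[dup] /infiniteP/card_leT_injP[e einj].
move=> /card_seq_le /card_leT_injP[c cinj].
pose code (s : seq X) (m : seq bitseq) := c (e (pickle m) :: s).
exists (fun Y => [set x | exists s m,
  x = code s m /\ [seq `[< Y y >] | y <- s] \in m]).
move=> S L; have [s sP] := separating_seq L.
exists (code s [seq [seq `[< Y x >] | x <- s] | Y <- L & `[< S Y >]]) => Y YL.
split=> [[s' [m' [/cinj[/einj /(pcan_inj pickleK) <- <-]]]]|SY].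
  move=> /mapP[Z]; rewrite mem_filter => /andP[/asboolP SZ ZL] /(sP _ _ YL ZL).
  by move=> ->.
eexists; eexists; split; first reflexivity.
by apply/map_f; rewrite mem_filter YL andbT; apply/asboolP.
Qed.

(** For every [S], the sets [B Y] with [Y] in [S] and the complements of the
others have the finite intersection property, so they lie in a common
ultrafilter [U S]; it contains [B Y] exactly when [Y] is in [S], whence [S] can
be recovered from it. *)
Lemma ultrafilter_family (X : Type) : infinite_set [set: X] ->
  exists U : set (set X) -> set_system X,
    (forall S, UltraFilter (U S)) /\ injective U.
Proof.
move=> /independent_family[B indep].
pose base (S : set (set X)) (L : seq (set X)) :=
  [set x | forall Y, Y \in L -> B Y x <-> S Y].
have /choice[U UP] : forall S, exists U,
    UltraFilter U /\ filter_from setT (base S) `<=` U.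
  move=> S; apply: ultraFilterLemma; apply: filter_from_proper; last first.
    by move=> L _; exact: indep.
  apply: filter_fromT_filter; first by exists [::].
  move=> L L'; exists (L ++ L') => x xP; split=> Y YL;
    by apply: xP; rewrite mem_cat YL ?orbT.
exists U; split=> [S|S T ST]; first by have [] := UP S.
have mem V Y : U V (B Y) <-> V Y.
  have [UV sub] := UP V; have UVB : U V (base V [:: Y]).
    by apply: sub; exists [:: Y].
  split=> [UBY|VY].
    have [x [/(_ Y) xP BYx]] := filter_ex (filterI UVB UBY).
    by apply/xP; rewrite ?inE.
  by apply: filterS UVB => x /(_ Y (mem_head _ _))[_ /(_ VY)].
apply/funext => Y; apply/propext.
by split=> /mem UBY; apply/mem; [rewrite -ST|rewrite ST].
Qed.

(** * The clone of an ultrafilter *)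

(** For an ultrafilter [F], the sets whose complement is in [F] form a maximal
ideal, and this is the set of the operations that preserve this ideal.  Being
defined for any [F], it is already a clone for a filter. *)
Definition null_preserving (X : Type) (F : set_system X) : set (operation X) :=
  [set o | forall A, F (~` A) ->
    F (~` [set apply_op o x | x in [set x | forall i, A (x i)]])].

Section NullPreserving.
Variables (X : Type) (F : set_system X).
Hypothesis FF : Filter F.

Lemma null_preserving_clone : is_clone (null_preserving F).
Proof.
split=> [n k A FA|n k g f Cg Cf A FA].
  by apply: filterS FA => x nAx [y Ay yx]; apply: nAx; rewrite -yx; exact: Ay.
pose B := [set y | exists i, [set f i x | x in [set x | forall i, A (x i)]] y].
have FB : F (~` B).
  have := @filter_forall _ _ _ _ FF (fun i => Cf i A FA).
  by apply: filterS => y yP [i fy]; exact: yP i fy.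
apply: filterS (Cg B FB) => y nBy [x Ax xy]; apply: nBy.
by exists (fun i => f i x) => // i; exists i, x.
Qed.

Lemma null_range_preserving (n : nat) (f : nary X n.+1) (A : set X) :
  F (~` A) -> (forall x, A (f x)) -> null_preserving F (op f).
Proof.
by move=> FA fA B _; apply: filterS FA => y nAy [x _ xy]; apply: nAy; rewrite -xy.
Qed.

Lemma conservative_preserving (n : nat) (f : nary X n.+1) :
  (forall x, exists i, f x = x i) -> null_preserving F (op f).
Proof.
move=> fP A FA; apply: filterS FA => y nAy [x Ax xy]; apply: nAy.
by rewrite -xy /=; have [i ->] := fP x.
Qed.

End NullPreserving.

Section UltraPreserving.
Variables (X : pointedType) (F : set_system X).
Hypothesis FU : UltraFilter F.
Hypothesis Xinf : infinite_set [set: X].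

(** An injection [h : X -> X] with null range exists, because [X] contains two
disjoint copies of itself, at most one of which is in [F].  A left inverse of
[h] maps that null range onto [X]. *)
Lemma null_preserving_proper : null_preserving F <> setT.
Proof.
move=> CT.
have [e einj] := card_leT_injP (iffLR (infiniteP _) Xinf).
have [c cinj] := card_leT_injP (card_square_le Xinf).
have [h hinj Fh] : exists2 h : X -> X, injective h & F (~` range h).
  have [F0|F0] := in_ultra_setVsetC (range (fun x => c (e 0, x))) FU; last first.
    by exists (fun x => c (e 0, x)) => // x y /cinj[].
  exists (fun x => c (e 1, x)) => [x y /cinj[]//|].
  by apply: filterS F0 => _ [x _ <-] [y _ /cinj[/einj]].
have : null_preserving F (op (fun x : 'I_1 -> X => pinv setT h (x ord0))).
  by rewrite CT.
move=> /(_ _ Fh) /filter_ex[y]; apply; exists (fun=> h y) => [i|]; first by exists y.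
by rewrite /= pinvKV ?inE// => u v _ _ /hinj.
Qed.

(** At most one singleton is in an ultrafilter, so two among any three points
form a null pair, even when [F] is principal.  Every operation with values in
such a pair belongs to the clone, and can serve as a test. *)
Lemma null_pair : exists p q : X, p <> q /\ F (~` [set p; q]).
Proof.
have [e einj] := card_leT_injP (iffLR (infiniteP _) Xinf).
have neq i j : i <> j -> e i <> e j by move=> ij /einj.
have avoid i j k : k <> i -> k <> j -> F [set e k] -> F (~` [set e i; e j]).
  by move=> ki kj; apply: filterS => _ -> [] /einj.
have [F0|F0] := in_ultra_setVsetC [set e 0] FU.
  by exists (e 1), (e 2); split; [exact: neq|exact: avoid F0].
have [F1|F1] := in_ultra_setVsetC [set e 1] FU.
  by exists (e 0), (e 2); split; [exact: neq|exact: avoid F1].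
exists (e 0), (e 1); split; first exact: neq.
by rewrite setCU; exact: filterI.
Qed.

(** Every [f] is the composition of a selector [m], which returns its second or
third argument according to the first, with three operations of [D]: [f1]
agrees with [f] where [f] has its values in [B] and is obtained from [g];
[f2] agrees with [f] elsewhere and has a null range; [s], with values in a
null pair, tells which case holds. *)
Lemma null_preserving_maximal (D : set (operation X)) :
  is_clone D -> null_preserving F `<` D -> D = setT.
Proof.
move=> [Dproj Dcomp] [CD DC].
have [[k g] Dg nCg] : exists2 o, D o & ~ null_preserving F o.
  apply: contrapT => nD; apply: DC => o Do.
  by apply: contrapT => nCo; apply: nD; exists o.
move: nCg => /existsNP[A /not_implyP[FA]]; set B := image _ _ => nFB.
have {nFB} FB : F B by have [|/nFB] := in_ultra_setVsetC B FU.
have [_ [a Aa _]] := filter_ex FB.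
(* A section of [g] over [B], with arbitrary values in [A^(k+1)] elsewhere, so
   that the range of each of its coordinates is contained in the null set [A]. *)
have /choice[h hP] : forall b, exists x : 'I_k.+1 -> X,
    (forall i, A (x i)) /\ (B b -> g x = b).
  move=> b; have [[x Ax xb]|nBb] := pselect (B b); first by exists x.
  by exists a.
have [p [q [pq Fpq]]] := null_pair.
have Dsmall n (f : nary X n.+1) Z : F (~` Z) -> (forall x, Z (f x)) -> D (op f).
  by move=> FZ fZ; apply: CD; exact: null_range_preserving FZ fZ.
apply/seteqP; split=> // -[n f] _.
pose f1 : nary X n.+1 := composition g (fun i x => h (f x) i).
pose f2 : nary X n.+1 := fun x => if f x \in B then p else f x.
pose s : nary X n.+1 := fun x => if f x \in B then p else q.
pose m : nary X 3 := fun t => if t ord0 == p then t (inord 1) else t (inord 2).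
have Df1 : D (op f1).
  apply: Dcomp => // i; apply: (Dsmall _ _ A) => // x.
  by have [] := hP (f x).
have Df2 : D (op f2).
  apply: (Dsmall _ _ (~` B `|` [set p; q])) => [|x].
    by rewrite setCU setCK; exact: filterI.
  rewrite /f2; case: (boolP (f x \in B)) => [_|/negP nBfx]; first by right; left.
  by left => Bfx; apply: nBfx; rewrite inE.
have Ds : D (op s).
  apply: (Dsmall _ _ [set p; q]) => // x.
  by rewrite /s; case: ifP => _; [left|right].
have Dm : D (op m).
  apply: CD; apply: conservative_preserving => t; rewrite /m.
  by case: ifP => _; eexists.
suff -> : f = composition m (fun i => nth s [:: s; f1; f2] i).
  apply: Dcomp => // i; case: i => -[|[|[|//]]] /= _ //.
apply/funext => x; rewrite /composition /m !inordK//= /s.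
case: (boolP (f x \in B)) => [/set_mem Bfx|nB].
  by rewrite eqxx /f1 /composition; have [_ ->] := hP (f x).
case: eqP => [/esym//|_].
by rewrite /f2 (negbTE nB).
Qed.

End UltraPreserving.

(** A map onto [A] that maps the subset [j @` A] of [~` A] onto [A] has a
[G]-null range, so it preserves [G]-null sets; but it maps the [F]-null set
[~` A] onto [A], which is in [F]. *)
Lemma null_preserving_neq (X : pointedType) (F G : set_system X) (A : set X) :
  UltraFilter F -> UltraFilter G -> F A -> G (~` A) -> A #<= ~` A ->
  null_preserving F <> null_preserving G.
Proof.
move=> FU GU FA GA /card_le_injP[j jA jinj] FG.
have [a Aa] := filter_ex FA.
pose f : nary X 1 := fun x => if x ord0 \in j @` A then pinv A j (x ord0) else a.
have fA x : A (f x).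
  rewrite /f; case: ifP => // /set_mem[y Ay <-].
  by rewrite pinvKV ?inE.
have : null_preserving F (op f) by rewrite FG; exact: null_range_preserving GA fA.
move=> /(_ (~` A)); rewrite setCK => /(_ FA) FfA.
have [y [Ay nfy]] := filter_ex (filterI FA FfA).
apply: nfy; exists (fun=> j y); first by move=> i; exact: jA.
rewrite /= /f ifT ?inE; last by exists y.
by rewrite pinvKV ?inE.
Qed.

(** A set on which the two ultrafilters differ and its complement have
comparable cardinals; the roles of the filters are exchanged when the
complement is the smaller one. *)
Lemma null_preserving_inj (X : pointedType) (F G : set_system X) :
  UltraFilter F -> UltraFilter G ->
  null_preserving F = null_preserving G -> F = G.
Proof.
move=> FU GU FG; apply/esym/max_filter => A FA; apply: contrapT => nGA.
have {nGA} GA : G (~` A) by have [/nGA|] := in_ultra_setVsetC A GU.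
have [AC|CA] := card_le_total A (~` A).
  exact: null_preserving_neq FA GA AC FG.
by apply: (null_preserving_neq GU FU GA _ _ (esym FG)); rewrite setCK.
Qed.

(** * The number of precomplete clones *)

Theorem mainTheorem2 (X : Type) (hX : infinite_set [set: X]) :
  [set C : set (operation X) | is_precomplete C] #= [set: set (set X)].
Proof.
elim/Ppointed: X => X in hX *.
  by exfalso; apply: hX; rewrite emptyE; exact: finite_set0.
apply/card_eqPle; split.
  apply: card_le_trans (card_leT _) _; apply: card_le_set.
  exact: card_operation_le.
have [U [UU Uinj]] := ultrafilter_family hX.
apply: (card_le_inj (f := fun S => null_preserving (U S))) => [S _|S T _ _].
- split.
  + exact: null_preserving_clone.
  + exact: null_preserving_proper.
  + by move=> D; exact: null_preserving_maximal.
- by move=> /null_preserving_inj UST; exact/Uinj/UST.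
Qed.
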